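(* Let $d$ be a negative integer and let $e:=|d|$. Then the generating function $L_e(x,y)$ of the (nonempty) $d$-Dyck paths with respect to semi-length and number of peaks satisfies the functional equation $$L_e(x,y)= xy+xL_e(x,y)+xS_e(x,y)L_e(x,y),$$ where $S_e(x,y)$ satisfies the algebraic equation $$(1-xS_e(x,y))^e\bigl(y+(1-y)xS_e(x,y)\bigr)-S_e(x,y)(1-xS_e(x,y))^{e+1}-\frac{x^{e+2}y}{1-x}S_e(x,y)=0.$$
   Context: A Dyck path is a lattice path in the first quadrant that starts at the origin, ends on the $x$-axis, and consists of steps $U=(1,1)$ and $D=(1,-1)$ (never going below the $x$-axis). Its semi-length $\ell(P)$ is its number of $U$ steps. A peak is an occurrence of two consecutive steps $UD$; $\rho(P)$ denotes the number of peaks. A valley is an occurrence of two consecutive steps $DU$; the level of a valley is the $y$-coordinate of its lowest point. Let $\nu=(\nu_1,\dots,\nu_k)$ be the levels of all valleys of $P$, listed from left to right. For $d\in\mathbb Z$, a Dyck path is called $d$-Dyck if it has at most one valley or if $\nu_{i+1}-\nu_i\ge d$ for all $1\le i<k$. For $d<0$ and $e=|d|$, $L_e(x,y)=\sum_{P}x^{\ell(P)}y^{\rho(P)}$ (a formal power series), where $P$ runs over all nonempty $d$-Dyck paths. For $i\ge 0$, let $Q_i^{(e)}(x,y)=\sum_{P}x^{\ell(P)}y^{\rho(P)}$, where $P$ runs over all $d$-Dyck paths that have at least one valley and whose last (rightmost) valley is at level $i$. Define $$S_e(x,y)=\frac{y}{1-x}+\sum_{j=0}^{e-1}Q_j^{(e)}(x,y).$$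 *)

(* Defs.v *)
From HB Require Import structures.
From mathcomp Require Import all_boot all_order all_algebra.
From mathcomp Require Import boolp zify.

Set Implicit Arguments.
Unset Strict Implicit.
Unset Printing Implicit Defensive.

Import Order.TTheory GRing.Theory Num.Theory.
Local Open Scope ring_scope.

(* Univariate formal power series: the series \sum_n (fps_coef f n) X^n. *)
Record fps (R : Type) := Fps { fps_coef : nat -> R }.

Arguments Fps {R}.
Arguments fps_coef {R}.

HB.instance Definition _ (R : Type) := gen_eqMixin (fps R).
HB.instance Definition _ (R : Type) := gen_choiceMixin (fps R).

Lemma fpsP (R : Type) (f g : fps R) : fps_coef f =1 fps_coef g -> f = g.
Proof. by case: f g => [f] [g] /= /funext ->. Qed.

Section Ring.
Variable R : comNzRingType.
Implicit Types f g h : fps R.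

Definition fps_zero : fps R := Fps (fun=> 0).
Definition fps_opp f : fps R := Fps (fun n => - fps_coef f n).
Definition fps_add f g : fps R := Fps (fun n => fps_coef f n + fps_coef g n).
Definition fpsC (c : R) : fps R := Fps (fun n => if n == 0%N then c else 0).
Definition fpsX : fps R := Fps (fun n => (n == 1%N)%:R).
Definition fps_mul f g : fps R :=
  Fps (fun n => \sum_(i < n.+1) fps_coef f i * fps_coef g (n - i)).

Let fps_addA : associative fps_add.
Proof. by move=> f g h; apply: fpsP => n; apply: addrA. Qed.
Let fps_addC : commutative fps_add.
Proof. by move=> f g; apply: fpsP => n; apply: addrC. Qed.
Let fps_add0 : left_id fps_zero fps_add.
Proof. by move=> f; apply: fpsP => n; apply: add0r. Qed.
Let fps_addN : left_inverse fps_zero fps_opp fps_add.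
Proof. by move=> f; apply: fpsP => n; apply: addNr. Qed.

HB.instance Definition _ :=
  GRing.isZmodule.Build (fps R) fps_addA fps_addC fps_add0 fps_addN.

Definition fps_trunc m f : {poly R} := \poly_(i < m.+1) fps_coef f i.

Lemma coef_fps_trunc m f i :
  (i <= m)%N -> (fps_trunc m f)`_i = fps_coef f i.
Proof. by move=> le_im; rewrite coef_poly ltnS le_im. Qed.

Lemma coef_fps_mul_trunc m f g n : (n <= m)%N ->
  fps_coef (fps_mul f g) n = (fps_trunc m f * fps_trunc m g)`_n.
Proof.
move=> le_nm; rewrite coefM; apply: eq_bigr => i _.
have le_in : (i <= n)%N by rewrite -ltnS.
by rewrite !coef_fps_trunc ?(leq_trans le_in) // (leq_trans (leq_subr _ _)).
Qed.

Let fps_mulC : commutative fps_mul.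
Proof.
by move=> f g; apply: fpsP => n; rewrite !(@coef_fps_mul_trunc n) // mulrC.
Qed.

Let fps_mulA : associative fps_mul.
Proof.
move=> f g h; apply: fpsP => n.
transitivity (fps_trunc n f * (fps_trunc n g * fps_trunc n h))`_n.
  rewrite coefM; apply: eq_bigr => i _.
  have le_in : (i <= n)%N by rewrite -ltnS.
  by rewrite coef_fps_trunc // (@coef_fps_mul_trunc n) // leq_subr.
rewrite mulrA coefM; apply: eq_bigr => i _.
have le_in : (i <= n)%N by rewrite -ltnS.
by rewrite (@coef_fps_mul_trunc n) // coef_fps_trunc // leq_subr.
Qed.

Let fps_mul1 : left_id (fpsC 1) fps_mul.
Proof.
move=> f; apply: fpsP => n /=; rewrite big_ord_recl /= mul1r subn0.
by rewrite big1 ?addr0 // => i _; rewrite mul0r.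
Qed.

Let fps_mulDl : left_distributive fps_mul fps_add.
Proof.
move=> f g h; apply: fpsP => n /=; rewrite -big_split /=.
by apply: eq_bigr => i _; rewrite mulrDl.
Qed.

Let fps_1neq0 : fpsC 1 != 0 :> fps R.
Proof.
by apply/eqP => /(congr1 (fun f => fps_coef f 0)) /eqP; rewrite /= oner_eq0.
Qed.

HB.instance Definition _ := GRing.Zmodule_isComNzRing.Build (fps R)
  fps_mulA fps_mulC fps_mul1 fps_mulDl fps_1neq0.

End Ring.

Arguments fpsX {R}.

Section Unit.
Variable R : comUnitRingType.
Implicit Types f g : fps R.

(* Coefficients 0, ..., n of the inverse g of f, from the recurrence
   f_0 g_n = - \sum_(i < n) f_(n - i) g_i, with f_0 g_0 = 1. *)
Fixpoint fps_inv_seq f (n : nat) : seq R :=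
  if n is m.+1 then
    let s := fps_inv_seq f m in
    rcons s (- (fps_coef f 0)^-1 * \sum_(i < n) fps_coef f (n - i) * s`_i)
  else [:: (fps_coef f 0)^-1].

Definition fps_unit : pred (fps R) :=
  fun f => fps_coef f 0 \is a GRing.unit.

Definition fps_inv f : fps R :=
  if fps_unit f then Fps (fun n => (fps_inv_seq f n)`_n) else f.

Lemma size_fps_inv_seq f n : size (fps_inv_seq f n) = n.+1.
Proof. by elim: n => //= n IHn; rewrite size_rcons IHn. Qed.

Lemma nth_fps_inv_seq f m n :
  (n <= m)%N -> (fps_inv_seq f m)`_n = (fps_inv_seq f n)`_n.
Proof.
elim: m => [|m IHm]; first by rewrite leqn0 => /eqP ->.
rewrite leq_eqVlt => /predU1P[-> //|lt_nm] /=.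
by rewrite nth_rcons size_fps_inv_seq lt_nm IHm.
Qed.

Let fps_mulV : {in fps_unit, left_inverse 1 fps_inv *%R}.
Proof.
move=> f Uf; rewrite /fps_inv; have -> : fps_unit f = true by [].
apply: fpsP => -[|n] /=.
  by rewrite big_ord_recl big_ord0 addr0 /= mulVr.
rewrite big_ord_recr /= nth_rcons size_fps_inv_seq ltnn eqxx subnn.
rewrite [X in _ + X]mulrAC mulNr mulVr // mulN1r; apply/eqP.
rewrite subr_eq0; apply/eqP/eq_bigr => i _.
rewrite mulrC (@nth_fps_inv_seq f n i) //.
by rewrite -ltnS.
Qed.

Let fps_unitP f g : g * f = 1 -> fps_unit f.
Proof.
move/(congr1 (fun h => fps_coef h 0)); rewrite /= big_ord_recl big_ord0 addr0.
by move=> gf1; apply/unitrPr; exists (fps_coef g 0); rewrite mulrC.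
Qed.

Let fps_inv_out : {in [predC fps_unit], fps_inv =1 id}.
Proof.
move=> f /negPf Uf; rewrite /fps_inv; case: ifP => // Uf1.
by rewrite -[fps_unit f]/(f \in fps_unit) Uf in Uf1.
Qed.

HB.instance Definition _ := GRing.ComNzRing_hasMulInverse.Build (fps R)
  fps_mulV fps_unitP fps_inv_out.

End Unit.

(* Z[[x, y]] as Z[[y]][[x]]: [fps_coef (fps_coef f n) k] is the coefficient of
   x^n y^k. *)
Notation series2 := (fps (fps int)).

Definition xvar : series2 := fpsX.
Definition yvar : series2 := fpsC fpsX.

Lemma subr1_xvar_unit : 1 - xvar \is a GRing.unit.
Proof.
rewrite -[_ \is a _]/(fps_coef (fps_coef (1 - xvar) 0) 0 \is a GRing.unit).
by rewrite -[fps_coef _ 0]/(1 - 0 : int) subr0 unitr1.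
Qed.

(* A lattice path starting at the origin is its sequence of steps. *)
Notation U := true (only parsing).
Notation D := false (only parsing).

Definition step (s : bool) : int := if s then 1 else -1.

Definition height (w : seq bool) : int := \sum_(s <- w) step s.

Definition dyck (w : seq bool) : bool :=
  all (fun i => 0 <= height (take i w)) (iota 0 (size w).+1)
  && (height w == 0).

Definition semilength (w : seq bool) : nat := count_mem U w.

Definition occurrences (s w : seq bool) : seq nat :=
  [seq i <- iota 0 (size w) | prefix s (drop i w)].

Definition peaks (w : seq bool) : nat := size (occurrences [:: U; D] w).

(* The lowest point of a valley [:: D; U] at position i is reached after i.+1
   steps. *)
Definition valley_levels (w : seq bool) : seq int :=
  [seq height (take i.+1 w) | i <- occurrences [:: D; U] w].

Definition ddyck (d : int) (w : seq bool) : bool :=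
  let nu := valley_levels w in
  dyck w && ((size nu <= 1)%N || sorted (fun a b => d <= b - a) nu).

Lemma height_semilength w :
  height w = (semilength w).*2%:Z - (size w)%:Z.
Proof.
rewrite /height /semilength; elim: w => [|s w IHw]; first by rewrite big_nil.
by rewrite big_cons IHw; case: s; rewrite /step /=; lia.
Qed.

Lemma dyck_size w : dyck w -> size w = (semilength w).*2.
Proof. by case/andP=> _; rewrite height_semilength subr_eq0 => /eqP[]. Qed.

(* \sum_P x^(semilength P) y^(peaks P) over the paths P of a class A of Dyck
   paths. By [dyck_size], the paths of A of semilength n all have 2n steps. *)
Definition path_gf (A : pred (seq bool)) : series2 :=
  Fps (fun n => Fps (fun k =>
    #|[set w : (n.*2).-tuple bool |
       [&& A w, semilength w == n & peaks w == k]]|%:R)).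

Definition L_gf (d : int) : series2 :=
  path_gf (fun w => ddyck d w && (w != [::])).

Definition Q_gf (d : int) (i : nat) : series2 :=
  path_gf (fun w => [&& ddyck d w, (0 < size (valley_levels w))%N
                      & last 0 (valley_levels w) == i%:Z]).

Definition S_gf (d : int) : series2 :=
  yvar / (1 - xvar) + \sum_(j < `|d|%N) Q_gf d j.

(* Main.v *)
Require Import Defs.
From mathcomp Require Import all_boot all_order all_algebra.
From mathcomp Require Import boolp zify ring.

Import Order.TTheory GRing.Theory Num.Theory.
Local Open Scope ring_scope.

(** The identities come from the first-return decomposition: a nonempty Dyck
path is, in exactly one way, P = U u D v with u and v Dyck paths. When v is
nonempty, the valley levels of P are those of u raised by 1, then 0, then those
of v. As d < 0 and the levels of v are nonnegative, the step from 0 to the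
first level of v is never constrained, so P is d-Dyck exactly when u and v are
and u has no valley or a last valley at level less than e = |d|. Call U u D a
low prime when u is d-Dyck and satisfies this last condition; let T be the
generating function of low primes and Pi that of the pyramids U^n D^n with
n >= 1, that is, of the nonempty Dyck paths without valleys. Sorting the paths
of each class by their first return ([path_gf_first_return]) gives
- Pi = x y + x Pi, so Pi = x y / (1 - x);
- T = Pi + x (Q_0 + ... + Q_(e-1)) = x S;
- L = x y + x L + T L, the first identity;
- Q_0 = T (Pi + Q_0) and Q_(i+1) = x Q_i + T Q_(i+1).

With r = 1 - x S and q = y / (1 - x) this yields
r^(i+1) Q_i = x^i x^2 S q. Multiplying S = q + Q_0 + ... + Q_(e-1) by r^e
produces the geometric sum (r^e - x^e) / (r - x), and clearing its
denominator leaves the second identity ([algebraic_equation]). *)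

(** * Dyck paths and the first return *)

Section Paths.
Set Implicit Arguments.
Unset Strict Implicit.
Implicit Types (s : bool) (u v w : seq bool) (d : int).

Lemma height_nil : height [::] = 0.
Proof. by rewrite /height big_nil. Qed.

Lemma height_cons s w : height (s :: w) = step s + height w.
Proof. by rewrite /height big_cons. Qed.

Lemma height_cat u v : height (u ++ v) = height u + height v.
Proof. by rewrite /height big_cat. Qed.

Lemma dyckP w :
  reflect ((forall i, 0 <= height (take i w)) /\ height w = 0) (dyck w).
Proof.
apply: (iffP andP) => [[/allP ge0 /eqP h0]|[ge0 h0]]; split => //.
- move=> i; case: (leqP i (size w)) => [le_i|lt_i].
    by apply: ge0; rewrite mem_iota ltnS.
  by rewrite take_oversize ?h0 // ltnW.
- by apply/allP => i _; apply: ge0.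
- exact/eqP.
Qed.

Lemma dyck_nil : dyck [::].
Proof. by apply/dyckP; split=> [i|]; rewrite ?height_nil. Qed.

Lemma dyck_cat u v : dyck u -> dyck v -> dyck (u ++ v).
Proof.
move=> /dyckP[ge0u h0u] /dyckP[ge0v h0v]; apply/dyckP; split=> [i|].
  by rewrite take_cat; case: ifP => // _; rewrite height_cat h0u add0r.
by rewrite height_cat h0u h0v.
Qed.

(** The path U u D: for a Dyck path u, a Dyck path that returns to the axis only
at its end. *)
Definition prime_path u : seq bool := U :: rcons u D.

Lemma height_prime_path u : height (prime_path u) = height u.
Proof.
rewrite /prime_path height_cons -cats1 height_cat height_cons height_nil /=.
by lia.
Qed.

Lemma dyck_prime_path u : dyck u -> dyck (prime_path u).
Proof.
move=> /dyckP[ge0 h0]; apply/dyckP; split; last by rewrite height_prime_path.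
case=> [|i]; first by rewrite height_nil.
rewrite /= height_cons -cats1 take_cat; case: ifP => _ /=.
  by have := ge0 i; lia.
rewrite height_cat h0; case: (_ - _)%N => [|j] /=; first by rewrite height_nil.
by rewrite height_cons height_nil.
Qed.

Lemma dyck_first_return w : dyck w -> w != [::] ->
  exists u v, [/\ dyck u, dyck v & w = prime_path u ++ v].
Proof.
move=> /dyckP[ge0 h0]; case: w ge0 h0 => [//|s w] ge0 h0 _.
have Us : s = U.
  by have := ge0 1%N; rewrite /= take0 height_cons height_nil; case: (s).
subst s.
have exret : exists i,
    (i < size (U :: w))%N && (height (take i.+1 (U :: w)) == 0).
  by exists (size w); rewrite ltnSn take_oversize //= h0 eqxx.
(* In the main case p is the number of steps strictly between the first step
   and the step that first returns to the axis. *)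
case: (ex_minnP exret) => -[|p] /andP[lt_p /eqP hp] minp.
  by move: hp; rewrite /= take0 height_cons height_nil.
have inner_ge0 i : (i < p.+1)%N -> 0 <= height (take i w).
  move=> lt_i; have := ge0 i.+1; rewrite le_eqVlt => /predU1P[h|].
    have := minp i; rewrite -h eqxx (ltn_trans lt_i lt_p) => /(_ isT).
    by rewrite leqNgt lt_i.
  by rewrite /= height_cons /=; lia.
have hsplit : take p.+1 w = rcons (take p w) (nth D w p).
  by rewrite (take_nth D).
have [hD h0p] : nth D w p = D /\ height (take p w) = 0.
  move: hp; rewrite [take _ _]/= hsplit -cats1 height_cons height_cat.
  rewrite height_cons height_nil; have := inner_ge0 p (ltnSn p).
  by case: (nth D w p) => /=; split=> //; lia.
exists (take p w), (drop p.+1 w); split.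
- apply/dyckP; split=> // i; case: (ltnP i p) => lt_i.
    by rewrite take_takel ?(ltnW lt_i) //; apply: inner_ge0; apply: ltnW.
  by rewrite take_oversize ?h0p // size_take_min geq_min lt_i.
- have hd i : height (take i (drop p.+1 w)) =
      height (take (p.+2 + i) (U :: w)).
    rewrite takeD height_cat hp add0r.
    by congr (height (take _ _)).
  apply/dyckP; split=> [i|]; first by rewrite hd.
  by move: h0; rewrite -{1}[U :: w](cat_take_drop p.+2) height_cat hp add0r.
- by rewrite /prime_path -[X in rcons _ X]hD -hsplit /= cat_take_drop.
Qed.

(** Uniqueness of the first return: if u were shorter than u', then u' would
have the prefix u D, which ends below the axis. *)
Lemma prime_path_cat_inj u u' v v' : dyck u -> dyck u' ->
  prime_path u ++ v = prime_path u' ++ v' -> prime_path u = prime_path u'.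
Proof.
wlog le_uu' : u u' v v' / (size u <= size u')%N.
  move=> H; case: (leqP (size u) (size u')) => [|/ltnW] le Du Du' E.
    exact: H E.
  by symmetry; apply: (H _ _ v' v).
move=> /dyckP[_ h0] /dyckP[ge0 _] [E].
have eqsz : size u = size u'.
  apply/eqP; rewrite eqn_leq le_uu' leqNgt; apply/negP => lt_uu'.
  have := ge0 (size u).+1.
  have -> : take (size u).+1 u' = rcons u D.
    have := congr1 (take (size u).+1) E.
    by rewrite !take_cat !size_rcons ltnn subnn take0 cats0 ltnS lt_uu'
       -[rcons u' D]cats1 takel_cat.
  by rewrite -cats1 height_cat height_cons height_nil h0.
move/eqP: E; rewrite /prime_path eqseq_cat ?size_rcons ?eqsz //.
by case/andP=> /eqP->.
Qed.

Lemma prime_path_cat_nil u u' v : dyck u -> dyck u' ->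
  prime_path u = prime_path u' ++ v -> v = [::].
Proof.
move=> Du Du' E; have := @prime_path_cat_inj u u' [::] v Du Du'.
rewrite cats0 => /(_ E) eqp; move: E; rewrite -eqp -[LHS]cats0.
by move/eqP; rewrite eqseq_cat // eqxx => /eqP.
Qed.

Lemma semilength_cat u v :
  semilength (u ++ v) = (semilength u + semilength v)%N.
Proof. exact: count_cat. Qed.

Lemma semilength_prime_path u : semilength (prime_path u) = (semilength u).+1.
Proof. by rewrite /semilength /= -cats1 count_cat addn0. Qed.

(** * Peaks and valleys *)

Lemma occurrences_cons a b s w : occurrences [:: a; b] (s :: w) =
  nseq ((s == a) && (ohead w == Some b)) 0%N
    ++ [seq i.+1 | i <- occurrences [:: a; b] w].
Proof.
rewrite /occurrences /= (iotaDl 1 0) filter_map.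
have -> : (a == s) && prefix [:: b] w = (s == a) && (ohead w == Some b).
  rewrite eq_sym; congr (_ && _); case: w => [|c w] //=.
  by rewrite prefix0s andbT eq_sym.
by case: (_ && _).
Qed.

Lemma peaks_cons s w :
  peaks (s :: w) = ((s && (ohead w == Some D)) + peaks w)%N.
Proof.
by rewrite /peaks occurrences_cons size_cat size_nseq size_map eqb_id.
Qed.

Lemma valley_levels_cons s w : valley_levels (s :: w) =
  nseq (~~ s && (ohead w == Some U)) (step s)
    ++ [seq step s + l | l <- valley_levels w].
Proof.
rewrite /valley_levels occurrences_cons map_cat -!map_comp eqbF_neg.
congr (_ ++ _); last by apply: eq_map => i /=; rewrite height_cons.
by case: (_ && _) => //=; rewrite take0 height_cons height_nil addr0.
Qed.

(** The default [D] makes the boundary term vanish when u is empty; likewise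
for [U] in [valley_levels_cat]. *)
Lemma peaks_cat u v : peaks (u ++ v) =
  (peaks u + (last D u && (ohead v == Some D)) + peaks v)%N.
Proof.
elim: u => [|s u IHu] //=; rewrite !peaks_cons IHu.
by case: u {IHu} => [|a u] /=; [case: s => /=; lia | lia].
Qed.

Lemma valley_levels_cat u v : valley_levels (u ++ v) =
  valley_levels u ++ nseq (~~ last U u && (ohead v == Some U)) (height u)
   ++ [seq height u + l | l <- valley_levels v].
Proof.
elim: u => [|s u IHu] /=.
  by rewrite height_nil; under eq_map do rewrite add0r; rewrite map_id.
rewrite !valley_levels_cons IHu !map_cat map_nseq height_cons.
move: (valley_levels v) => lv.
have -> : [seq step s + l | l <- [seq height u + l | l <- lv]] =
  [seq step s + height u + l | l <- lv].
  by rewrite -map_comp; apply: eq_map => l /=; rewrite addrA.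
case: u {IHu} => [|a u] /=; last by rewrite catA.
by rewrite height_nil addr0 andbF.
Qed.

Lemma dyck_ohead w : dyck w -> w != [::] -> ohead w = Some U.
Proof.
move=> /dyckP[ge0 _]; case: w ge0 => [//|s w] /(_ 1%N).
by rewrite /= take0 height_cons height_nil; case: s.
Qed.

Lemma dyck_last w : dyck w -> ~~ last D w.
Proof.
move=> /dyckP[ge0 h0]; case/lastP: w ge0 h0 => [//|w s] ge0.
rewrite last_rcons -cats1 height_cat height_cons height_nil.
have := ge0 (size w); rewrite -cats1 take_size_cat //.
by case: s {ge0} => //=; lia.
Qed.

(** The hypothesis on u is needed: U D has a peak, the empty path has none. *)
Lemma peaks_prime_path u : dyck u -> u != [::] ->
  peaks (prime_path u) = peaks u.
Proof.
move=> Du u0; rewrite /prime_path peaks_cons -cats1 peaks_cat.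
rewrite (negPf (dyck_last Du)).
move: (dyck_ohead Du u0); case: u {Du u0} => [//|? ?] /= [->].
by rewrite add0n addn0; apply: addn0.
Qed.

Lemma peaks_prime_path_cat u v : peaks (prime_path u ++ v) =
  (peaks (prime_path u) + peaks v)%N.
Proof. by rewrite peaks_cat /= last_rcons /= addn0. Qed.

Lemma valley_levels_prime_path u : dyck u ->
  valley_levels (prime_path u) = [seq 1 + l | l <- valley_levels u].
Proof.
move=> Du; rewrite valley_levels_cons -cats1 valley_levels_cat /= !cats0.
by rewrite andbF /= cats0.
Qed.

Lemma valley_levels_prime_path_cat u v : dyck u -> dyck v -> v != [::] ->
  valley_levels (prime_path u ++ v) =
    [seq 1 + l | l <- valley_levels u] ++ 0 :: valley_levels v.
Proof.
move=> Du Dv v0.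
rewrite valley_levels_cat dyck_ohead // eqxx andbT /= last_rcons.
have [_ h0] := dyckP _ Du.
rewrite height_prime_path h0 valley_levels_prime_path //=.
have -> : [seq 0 + l | l <- valley_levels v] = valley_levels v.
  by under eq_map do rewrite add0r; rewrite map_id.
by [].
Qed.

Lemma valley_levels_ge0 w : dyck w -> all (fun l => 0 <= l) (valley_levels w).
Proof.
by move=> /dyckP[ge0 _]; rewrite /valley_levels; apply/allP => _ /mapP[i _ ->].
Qed.

End Paths.

(** * Generating functions of sets of paths *)

Section WordSums.
Set Implicit Arguments.
Unset Strict Implicit.
Implicit Types (F : seq bool -> int) (A B C : pred (seq bool)) (w : seq bool).

(** The sum of F over all words of length m; m is a plain number, so lengths
can be rewritten without casting tuples. *)
Definition word_sum m F : int := \sum_(w : m.-tuple bool) F w.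

Lemma eq_word_sum m F1 F2 : F1 =1 F2 -> word_sum m F1 = word_sum m F2.
Proof. by move=> eqF; apply: eq_bigr. Qed.

Lemma word_sum0 F : word_sum 0 F = F [::].
Proof.
rewrite /word_sum (big_pred1 [tuple of [::]]) // => w /=.
by apply/esym/eqP; apply: tuple0.
Qed.

Lemma word_sum_cons m F : word_sum m.+1 F =
  word_sum m (fun w => F (U :: w)) + word_sum m (fun w => F (D :: w)).
Proof.
rewrite /word_sum.
rewrite (reindex (fun p : bool * m.-tuple bool => [tuple of p.1 :: p.2])).
  rewrite -(pair_bigA _ (fun b (t : m.-tuple bool) => F (b :: t))) /=.
  by rewrite big_bool.
exists (fun t : m.+1.-tuple bool => (thead t, [tuple of behead t])).
  move=> [b t] _ /=; rewrite theadE.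
  by congr (_, _); apply: val_inj.
by move=> t _; rewrite /= -tuple_eta.
Qed.

Lemma word_sum_cat m1 m2 F : word_sum (m1 + m2) F =
  word_sum m1 (fun u => word_sum m2 (fun v => F (u ++ v))).
Proof.
by elim: m1 F => [|m1 IHm] F; rewrite ?word_sum0 // addSn !word_sum_cons !IHm.
Qed.

Lemma word_sumZ m c F : c * word_sum m F = word_sum m (fun w => c * F w).
Proof. exact: mulr_sumr. Qed.

Lemma word_sumD m F1 F2 : word_sum m (fun w => F1 w + F2 w) =
  word_sum m F1 + word_sum m F2.
Proof. exact: big_split. Qed.

Lemma word_sum_eq0 m F : (forall w, size w = m -> F w = 0) -> word_sum m F = 0.
Proof. by move=> F0; apply: big1 => w _; rewrite F0 ?size_tuple. Qed.

Lemma coef_path_gf A n k : fps_coef (fps_coef (path_gf A) n) k =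
  word_sum n.*2 (fun w => [&& A w, semilength w == n & peaks w == k]%:R).
Proof.
rewrite /= -sum1dep_card natr_sum big_mkcond /=.
by apply: eq_bigr => w _; case: ifP.
Qed.

Lemma fps_coef_sum (R : comNzRingType) (I : Type) (r : seq I) (P : pred I)
    (f : I -> fps R) n :
  fps_coef (\sum_(i <- r | P i) f i) n = \sum_(i <- r | P i) fps_coef (f i) n.
Proof. exact: (big_morph (fun f => fps_coef f n)). Qed.

Lemma series2P (f g : series2) :
  (forall n k, fps_coef (fps_coef f n) k = fps_coef (fps_coef g n) k) -> f = g.
Proof. by move=> eqfg; apply: fpsP => n; apply: fpsP => k. Qed.

Lemma path_gf_sum e (A : nat -> pred (seq bool)) C :
  (forall w, (C w : nat) = (\sum_(i < e) A i w)%N) ->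
  path_gf C = \sum_(i < e) path_gf (A i).
Proof.
move=> defC; apply: series2P => n k; rewrite !fps_coef_sum coef_path_gf.
under [RHS]eq_bigr do rewrite coef_path_gf.
rewrite /word_sum exchange_big /=; apply: eq_bigr => w _.
case: ((semilength w == n) && _); last first.
  by rewrite andbF big1 // => i _; rewrite andbF.
by rewrite andbT defC natr_sum; apply: eq_bigr => i _; rewrite andbT.
Qed.

Lemma path_gfU A B C : (forall w, C w = A w || B w) ->
  (forall w, A w -> B w -> False) -> path_gf C = path_gf A + path_gf B.
Proof.
move=> defC disjAB; apply: series2P => n k.
transitivity (fps_coef (fps_coef (path_gf A) n) k
  + fps_coef (fps_coef (path_gf B) n) k); last by [].
rewrite !coef_path_gf -word_sumD; apply: eq_word_sum => w.
rewrite defC; move: (disjAB w).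
case: (A w); case: (B w) => disj /=; rewrite ?add0r ?addr0 //.
by case: disj.
Qed.

Lemma path_gf_pred0 C : C =1 pred0 -> path_gf C = 0.
Proof.
move=> C0; apply: series2P => n k; rewrite coef_path_gf.
by apply: word_sum_eq0 => w _; rewrite C0.
Qed.

Lemma fps_coefX0 (R : comNzRingType) (f : fps R) : fps_coef (fpsX * f) 0 = 0.
Proof. by rewrite /= big_ord_recl big_ord0 /= mul0r addr0. Qed.

Lemma fps_coefXS (R : comNzRingType) (f : fps R) n :
  fps_coef (fpsX * f) n.+1 = fps_coef f n.
Proof.
rewrite /= big_ord_recl big_ord_recl /= mul0r mul1r add0r big1 => [|i _].
  by rewrite addr0 subn1.
by rewrite mul0r.
Qed.

Lemma path_gf_UD : path_gf (pred1 [:: U; D]) = xvar * yvar.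
Proof.
apply: series2P => -[|[|n]] k; rewrite coef_path_gf.
- by rewrite fps_coefX0 word_sum0.
- by rewrite fps_coefXS !word_sum_cons !word_sum0 /=; case: k => [|[|k]].
- rewrite fps_coefXS word_sum_eq0 // => w _ /=.
  by case: eqP => [->|].
Qed.

Lemma path_gf_prime A C : (forall u, A u -> dyck u && (u != [::])) ->
  (forall w, C w <-> exists2 u, A u & w = prime_path u) ->
  path_gf C = xvar * path_gf A.
Proof.
move=> DA defC; apply: series2P => -[|n] k; rewrite coef_path_gf.
  rewrite fps_coefX0 word_sum0.
  by case: (boolP (C _)) => // /defC[u _].
have CN w : ~ (exists u, w = prime_path u) -> C w = false.
  by move=> nex; apply/negP => /defC[u _ def_w]; apply: nex; exists u.
rewrite fps_coefXS coef_path_gf doubleS word_sum_cons.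
rewrite [X in _ + X]word_sum_eq0 ?addr0 => [|w _]; last first.
  by rewrite CN // => -[u].
rewrite -addn1 word_sum_cat; apply: eq_word_sum => u.
rewrite word_sum_cons !word_sum0 !cats1 CN ?add0r; last first.
  by case=> u' [/rcons_inj[]].
rewrite -/(prime_path u) semilength_prime_path eqSS.
have -> : C (prime_path u) = A u.
  apply/idP/idP => [/defC[u' Au' [/rcons_inj[->]]]//|Au].
  by apply/defC; exists u.
by case: (boolP (A u)) => // /DA/andP[Du u0]; rewrite peaks_prime_path.
Qed.

(** Concatenation with unique factorisation multiplies generating functions:
each word w of C is counted once on the right, at the cut position given by the
length of its A-part. *)
Lemma path_gf_cat A B C :
  (forall a, A a -> size a = (semilength a).*2) ->
  (forall b, B b -> size b = (semilength b).*2) ->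
  (forall a b a' b', A a -> A a' -> a ++ b = a' ++ b' -> a = a') ->
  (forall a b, A a -> B b -> peaks (a ++ b) = (peaks a + peaks b)%N) ->
  (forall w, C w <-> exists a b, [/\ A a, B b & w = a ++ b]) ->
  path_gf C = path_gf A * path_gf B.
Proof.
move=> szA szB prefA peaksAB defC; apply: series2P => n k.
(* G i j a b: the pair (a, b) contributes to the product of the coefficient of
   x^i y^j of A and that of x^(n - i) y^(k - j) of B. *)
pose G i j a b : bool := [&& A a, semilength a == i & peaks a == j] &&
  [&& B b, semilength b == (n - i)%N & peaks b == (k - j)%N].
transitivity (\sum_(i < n.+1) \sum_(j < k.+1)
    word_sum n.*2 (fun w => (G i j (take i.*2 w) (drop i.*2 w))%:R));
  last first.
  rewrite [RHS]/= fps_coef_sum; apply: eq_bigr => i _.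
  rewrite [RHS]/=; apply: eq_bigr => j _.
  transitivity (fps_coef (fps_coef (path_gf A) i) j *
    fps_coef (fps_coef (path_gf B) (n - i)) (k - j)); last by [].
  rewrite !coef_path_gf.
  have le_in : (i <= n)%N by rewrite -ltnS.
  have -> : n.*2 = (i.*2 + (n - i).*2)%N by rewrite -doubleD subnKC.
  rewrite word_sum_cat mulrC word_sumZ.
  apply: eq_bigr => a _; rewrite mulrC word_sumZ; apply: eq_word_sum => b.
  by rewrite take_size_cat ?drop_size_cat ?size_tuple // -natrM mulnb.
rewrite coef_path_gf.
under eq_bigr do rewrite /word_sum exchange_big /=.
rewrite exchange_big /=; apply: eq_bigr => w _.
have [Cw|nCw] := boolP (C w); last first.
  rewrite big1 // => i _; rewrite big1 // => j _.
  case: (boolP (G _ _ _ _)) => // /andP[/and3P[Aa _ _] /and3P[Bb _ _]].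
  case/negP: nCw; apply/defC; exists (take i.*2 w), (drop i.*2 w).
  by rewrite cat_take_drop.
have [a [b [Aa Bb def_w]]] := (defC w).1 Cw.
have GE (i : 'I_n.+1) (j : 'I_k.+1) : G i j (take i.*2 w) (drop i.*2 w) =
   [&& semilength a == i, peaks a == j & (semilength w == n) && (peaks w == k)].
  rewrite def_w semilength_cat peaksAB //; apply/idP/idP.
    case/andP=> /and3P[Aa' /eqP sa' /eqP pa'] /and3P[Bb' /eqP sb' /eqP pb'].
    have Ea : take i.*2 (a ++ b) = a.
      by apply: (prefA _ (drop i.*2 (a ++ b)) _ b) => //; apply: cat_take_drop.
    have Eb : drop i.*2 (a ++ b) = b.
      have := cat_take_drop i.*2 (a ++ b); rewrite Ea.
      by move/eqP; rewrite eqseq_cat // eqxx => /eqP.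
    rewrite Ea in sa' pa'; rewrite Eb in sb' pb'.
    rewrite sa' pa' sb' pb' !eqxx /= !subnKC ?eqxx //.
    - by rewrite -ltnS.
    - by rewrite -ltnS.
  case/and4P=> /eqP sa /eqP pa /eqP sw /eqP pw.
  rewrite /G -sa -pa -sw -pw -szA // take_size_cat // drop_size_cat //.
  by rewrite Aa Bb !addKn !eqxx.
under eq_bigr do under eq_bigr do rewrite GE.
have [/andP[/eqP sw /eqP pw]|_] :=
  boolP ((semilength w == n) && (peaks w == k)); last first.
  by rewrite big1 // => i _; rewrite big1 // => j _; rewrite !andbF.
have lt_a : (semilength a < n.+1)%N.
  by rewrite ltnS -sw def_w semilength_cat leq_addr.
have lt_p : (peaks a < k.+1)%N by rewrite ltnS -pw def_w peaksAB // leq_addr.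
rewrite (bigD1 (Ordinal lt_a)) //= (bigD1 (Ordinal lt_p)) //= !eqxx.
rewrite [X in _ + X + _]big1 => [|j neq_j]; last first.
  by move: neq_j; rewrite -val_eqE /= eq_sym => /negPf->.
rewrite big1 ?addr0 // => i neq_i; rewrite big1 // => j _.
by move: neq_i; rewrite -val_eqE /= eq_sym => /negPf->.
Qed.

End WordSums.

(** * Functional equations from the first return *)

Section FirstReturn.
Set Implicit Arguments.
Unset Strict Implicit.
Implicit Types (A B C T : pred (seq bool)) (u v w : seq bool) (d : int).

Lemma prime_path_inj : injective prime_path.
Proof. by move=> u u' [/rcons_inj[]]. Qed.

(** The nonempty paths U u D v of a class C are split into the path U D (present
when c holds), those with v empty and u nonempty, where u ranges over A, and
those with v nonempty, where U u D ranges over T and v over B independently. *)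
Lemma path_gf_first_return (c : bool) A B C T :
  (forall w, C w -> dyck w && (w != [::])) ->
  (forall w, A w -> dyck w && (w != [::])) ->
  (forall w, B w -> dyck w && (w != [::])) ->
  (forall w, T w -> exists2 u, dyck u & w = prime_path u) ->
  C (prime_path [::]) = c ->
  (forall u, dyck u -> u != [::] -> C (prime_path u) = A u) ->
  (forall u v, dyck u -> dyck v -> v != [::] ->
    C (prime_path u ++ v) = T (prime_path u) && B v) ->
  path_gf C = c%:R * (xvar * yvar) + xvar * path_gf A + path_gf T * path_gf B.
Proof.
move=> dC dA dB primeT C1 CA CTB.
pose C2 w := `[< exists2 u, A u & w = prime_path u >].
pose C3 w := `[< exists a b, [/\ T a, B b & w = a ++ b] >].
have gf1 : path_gf (fun w => c && (w == prime_path [::])) =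
    c%:R * (xvar * yvar).
  rewrite -path_gf_UD; case: (c); first by rewrite mul1r.
  by rewrite mul0r; apply: path_gf_pred0.
have gf2 : path_gf C2 = xvar * path_gf A.
  by apply: path_gf_prime => // w; split=> [/asboolP|?] //; apply/asboolP.
have gf3 : path_gf C3 = path_gf T * path_gf B.
  apply: path_gf_cat.
  - by move=> a /primeT[u Du ->]; apply/dyck_size/dyck_prime_path.
  - by move=> b /dB/andP[/dyck_size].
  - move=> a b a' b' /primeT[u Du ->] /primeT[u' Du' ->].
    exact: prime_path_cat_inj.
  - by move=> a b /primeT[u Du ->] _; apply: peaks_prime_path_cat.
  - by move=> w; split=> [/asboolP|?] //; apply/asboolP.
rewrite -gf1 -gf2 -gf3 -addrA -(@path_gfU C2 C3 (fun w => C2 w || C3 w)) //.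
  apply: path_gfU => [w|w /andP[_ /eqP->]].
    apply/idP/idP => [Cw|/or3P[/andP[c1 /eqP->]|/asboolP[u Au ->]|]].
    - have /andP[Dw w0] := dC w Cw.
      have [u [v [Du Dv def_w]]] := dyck_first_return Dw w0.
      rewrite def_w in Cw *; have [v0|v0] := eqVneq v [::].
        rewrite {v Dv def_w}v0 cats0 in Cw *.
        have [u0|u0] := eqVneq u [::].
          by rewrite u0 C1 in Cw *; rewrite Cw eqxx.
        apply/or3P/Or32/asboolP; exists u => //.
        by rewrite -CA.
      rewrite CTB // in Cw; have /andP[Tu Bv] := Cw.
      by apply/or3P/Or33/asboolP; exists (prime_path u), v.
    - by rewrite C1.
    - by have /andP[Du u0] := dA u Au; rewrite CA.
    - case/asboolP=> a [b [Ta Bb ->]]; have [u Du def_a] := primeT a Ta.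
      have /andP[Db b0] := dB b Bb.
      by rewrite def_a CTB // -def_a Ta.
  case/orP => /asboolP.
    by case=> u Au /prime_path_inj u0; move: (dA u Au); rewrite -u0 eqxx andbF.
  case=> a [b [Ta Bb E]]; have [u Du def_a] := primeT a Ta.
  move: (dB b Bb); rewrite def_a in E.
  by rewrite (prime_path_cat_nil dyck_nil Du E) andbF.
move=> w /asboolP[u' Au' ->] /asboolP[a [b [Ta Bb E]]].
have [u Du def_a] := primeT a Ta.
have /andP[Du' _] := dA u' Au'.
move: (dB b Bb); rewrite def_a in E.
by rewrite (prime_path_cat_nil Du' Du E) andbF.
Qed.

Lemma ddyckE d w :
  ddyck d w = dyck w && sorted (fun a b => d <= b - a) (valley_levels w).
Proof.
by rewrite /ddyck; case: (valley_levels w) => [|a [|b nu]]; rewrite /= ?orbT.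
Qed.

Lemma ddyck_dyck d w : ddyck d w -> dyck w.
Proof. by case/andP. Qed.

Lemma valley_levels_prime_path_eq0 u : dyck u ->
  (valley_levels (prime_path u) == [::]) = (valley_levels u == [::]).
Proof.
by move=> Du; rewrite valley_levels_prime_path //; case: valley_levels.
Qed.

Lemma last_valley_ge0 w : dyck w -> 0 <= last 0 (valley_levels w).
Proof.
move=> /valley_levels_ge0/allP ge0.
by have := mem_last 0 (valley_levels w); rewrite inE => /predU1P[->|/ge0].
Qed.

Lemma last_valley_prime_path u : dyck u -> valley_levels u != [::] ->
  last 0 (valley_levels (prime_path u)) = 1 + last 0 (valley_levels u).
Proof.
move=> Du; rewrite valley_levels_prime_path //.
by case: (valley_levels u) => //= a nu _; rewrite last_map.
Qed.

Lemma last_valley_prime_path_cat u v : dyck u -> dyck v -> v != [::] ->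
  last 0 (valley_levels (prime_path u ++ v)) = last 0 (valley_levels v).
Proof. by move=> *; rewrite valley_levels_prime_path_cat // last_cat. Qed.

Lemma ddyck_prime_path d u : dyck u -> ddyck d (prime_path u) = ddyck d u.
Proof.
move=> Du; rewrite !ddyckE dyck_prime_path // Du valley_levels_prime_path //.
by rewrite sorted_map; apply: eq_sorted => a b /=; lia.
Qed.

(** The condition on u under which U u D can be followed by a valley at level 0
in a d-Dyck path, for d < 0. *)
Definition low_last_valley d u : bool :=
  (valley_levels u == [::]) || (last 0 (valley_levels u) < `|d|%N%:Z).

Lemma ddyck_prime_path_cat d u v : d < 0 -> dyck u -> dyck v -> v != [::] ->
  ddyck d (prime_path u ++ v) =
    [&& ddyck d u, low_last_valley d u & ddyck d v].
Proof.
move=> d0 Du Dv v0; rewrite -(@ddyck_prime_path d u) // !ddyckE Dv.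
rewrite dyck_cat ?dyck_prime_path // valley_levels_prime_path_cat //=.
rewrite valley_levels_prime_path // /low_last_valley.
have -> s : sorted (fun a b => d <= b - a) (s ++ 0 :: valley_levels v) =
  sorted (fun a b => d <= b - a) (rcons s 0) &&
    sorted (fun a b => d <= b - a) (valley_levels v).
  have v_path : path (fun a b => d <= b - a) 0 (valley_levels v) =
      sorted (fun a b => d <= b - a) (valley_levels v).
    have := valley_levels_ge0 Dv.
    case: (valley_levels v) => //= a nu /andP[a0 _].
    by have -> : (d <= a - 0) = true by lia.
  by case: s => [|a s] /=; rewrite -v_path // cat_path rcons_path /= andbA.
rewrite andbA; congr (_ && _).
case: (valley_levels u) => [|a nu] //=; rewrite rcons_path; congr (_ && _).
by rewrite last_map; lia.
Qed.

(** Nonempty Dyck paths without valleys, that is, the paths U^n D^n, n >= 1. *)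
Definition pyramid w : bool :=
  [&& dyck w, w != [::] & valley_levels w == [::]].

(** The prime paths that can precede a nonempty d-Dyck path, for d < 0. *)
Definition low_prime d w : bool :=
  `[< exists u, [/\ ddyck d u, low_last_valley d u & w = prime_path u] >].

Lemma low_prime_path d u :
  low_prime d (prime_path u) = ddyck d u && low_last_valley d u.
Proof.
apply/asboolP/andP => [[u' [Du' lu' /prime_path_inj->]] //|[Du lu]].
by exists u.
Qed.

Lemma low_primeP d w : low_prime d w -> exists2 u, dyck u & w = prime_path u.
Proof. by case/asboolP=> u [/ddyck_dyck Du _ ->]; exists u. Qed.

Lemma pyramid_gf_eq : path_gf pyramid = xvar * yvar + xvar * path_gf pyramid.
Proof.
rewrite {1}(@path_gf_first_return true pyramid pred0 pyramid pred0) //.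
- by rewrite mul1r (path_gf_pred0 (C := pred0)) // mul0r addr0.
- by move=> w /and3P[-> ->].
- by move=> w /and3P[-> ->].
- by rewrite /pyramid valley_levels_prime_path_eq0 ?dyck_prime_path ?dyck_nil.
- move=> u Du u0; rewrite /pyramid valley_levels_prime_path_eq0 // Du u0.
  by rewrite dyck_prime_path.
- move=> u v Du Dv v0; apply/negP => /and3P[_ _].
  by rewrite valley_levels_prime_path_cat //; case: (valley_levels u).
Qed.

Lemma pyramid_gf : path_gf pyramid = xvar * (yvar / (1 - xvar)).
Proof.
apply: (mulIr subr1_xvar_unit); rewrite mulrA divrK ?subr1_xvar_unit //.
by rewrite mulrBr mulr1 {1}pyramid_gf_eq mulrC; ring.
Qed.

Lemma L_gf_eq d : d < 0 -> L_gf d =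
  xvar * yvar + xvar * L_gf d + path_gf (low_prime d) * L_gf d.
Proof.
pose dL w := ddyck d w && (w != [::]).
have dLP w : dL w -> dyck w && (w != [::]) by case/andP=> /ddyck_dyck-> ->.
move=> d0; rewrite /L_gf -/dL.
rewrite {1}(@path_gf_first_return true dL dL dL (low_prime d)) ?mul1r //.
- exact: low_primeP.
- by rewrite /dL ddyck_prime_path ?ddyckE dyck_nil.
- by move=> u Du u0; rewrite /dL ddyck_prime_path // u0.
- move=> u v Du Dv v0; rewrite /dL ddyck_prime_path_cat // low_prime_path v0.
  by rewrite !andbT andbA.
Qed.

(** The class of paths enumerated by [Q_gf d i]. *)
Definition last_valley_at d i w : bool :=
  [&& ddyck d w, (0 < size (valley_levels w))%N
    & last 0 (valley_levels w) == i%:Z].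

Lemma last_valley_atP d i w : last_valley_at d i w -> dyck w && (w != [::]).
Proof.
case/and3P=> /ddyck_dyck-> nu0 _.
by apply: contraTneq nu0 => ->.
Qed.

Lemma Q_gf0_eq d : d < 0 ->
  Q_gf d 0 = path_gf (low_prime d) * (path_gf pyramid + Q_gf d 0).
Proof.
move=> d0; rewrite /Q_gf -!/(last_valley_at d 0).
(* The final part v is a pyramid or has its own last valley at level 0; for
   a pyramid, the default value of [last] makes the last level 0. *)
pose B w := [&& ddyck d w, w != [::] & last 0 (valley_levels w) == 0].
rewrite -(@path_gfU _ _ B).
- rewrite (@path_gf_first_return false pred0 B _ (low_prime d)) //.
  + by rewrite mul0r (path_gf_pred0 (C := pred0)) // mulr0 !add0r.
  + exact: last_valley_atP.
  + by move=> w /and3P[/ddyck_dyck-> ->].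
  + exact: low_primeP.
  + by rewrite /last_valley_at valley_levels_prime_path ?dyck_nil // andbF.
  + move=> u Du u0; rewrite /last_valley_at; apply/negP => /and3P[_ nu0].
    rewrite last_valley_prime_path //; last first.
      by rewrite -valley_levels_prime_path_eq0 // -size_eq0 -lt0n.
    by have := last_valley_ge0 Du; lia.
  + move=> u v Du Dv v0; rewrite /last_valley_at ddyck_prime_path_cat //.
    rewrite last_valley_prime_path_cat // valley_levels_prime_path_cat //.
    by rewrite size_cat addnS /= low_prime_path /B v0 -!andbA.
- move=> w; rewrite /B /pyramid /last_valley_at ddyckE.
  case: (boolP (dyck w)) => //= Dw; case: w Dw => [|s w] _ //=.
  by case: (valley_levels (s :: w)) => //= a nu; rewrite orbF.
- by move=> w /and3P[_ _ /eqP nu0]; rewrite /last_valley_at nu0 andbF.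
Qed.

Lemma Q_gfS_eq d i : d < 0 -> Q_gf d i.+1 =
  xvar * Q_gf d i + path_gf (low_prime d) * Q_gf d i.+1.
Proof.
move=> d0; rewrite /Q_gf -!/(last_valley_at d _).
rewrite {1}(@path_gf_first_return false (last_valley_at d i)
  (last_valley_at d i.+1) _ (low_prime d)) ?mul0r ?add0r //.
- exact: last_valley_atP.
- exact: last_valley_atP.
- exact: last_valley_atP.
- exact: low_primeP.
- by rewrite /last_valley_at valley_levels_prime_path ?dyck_nil // andbF.
- move=> u Du u0; rewrite /last_valley_at ddyck_prime_path //.
  rewrite !lt0n !size_eq0 valley_levels_prime_path_eq0 //.
  case: eqVneq => [//|nu0] /=; rewrite last_valley_prime_path //.
  by rewrite -[i.+1]add1n PoszD (inj_eq (addrI _)).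
- move=> u v Du Dv v0; rewrite /last_valley_at ddyck_prime_path_cat //.
  rewrite last_valley_prime_path_cat // valley_levels_prime_path_cat //.
  rewrite size_cat addnS /= low_prime_path.
  case: (valley_levels v) => [|a nu] /=; first by rewrite !andbF.
  by rewrite -!andbA.
Qed.

Lemma low_prime_gf_eq d : d < 0 -> path_gf (low_prime d) =
  path_gf pyramid + xvar * \sum_(j < `|d|%N) Q_gf d j.
Proof.
move=> d0.
(* A: the possible nonempty interiors u; R: those with a valley. *)
pose A w := [&& ddyck d w, w != [::] & low_last_valley d w].
pose R w := [&& ddyck d w, valley_levels w != [::] & low_last_valley d w].
have gfR : path_gf R = \sum_(j < `|d|%N) Q_gf d j.
  apply: (@path_gf_sum _ (last_valley_at d)) => w.
  rewrite /R /last_valley_at.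
  have [Dw|] := boolP (ddyck d w); last by rewrite big1.
  have := last_valley_ge0 (ddyck_dyck Dw); rewrite /low_last_valley.
  rewrite lt0n size_eq0; case: eqVneq => /= [_ _|nu0]; first by rewrite big1.
  case: (last 0 (valley_levels w)) => [m _|//].
  have [lt_m|ge_m] := ltnP m `|d|%N.
    rewrite ltz_nat lt_m (bigD1 (Ordinal lt_m)) //= eqxx big1 // => j.
    by rewrite -val_eqE eq_sym eqz_nat => /negPf->.
  rewrite ltz_nat ltnNge ge_m big1 // => j _.
  by rewrite eqz_nat gtn_eqF // (leq_trans _ ge_m).
have gfA : path_gf A = path_gf pyramid + path_gf R.
  apply: path_gfU => w; rewrite /A /R /pyramid.
    rewrite ddyckE /low_last_valley; case: (boolP (dyck w)) => //= _.
    case: w => [|s w] //=.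
    by case: (valley_levels _) => [|a nu] //=.
  by case/and3P=> _ _ -> /and3P[].
rewrite {1}(@path_gf_first_return true A pred0 _ pred0) //.
- rewrite mul1r (path_gf_pred0 (C := pred0)) // mul0r addr0 gfA gfR mulrDr.
  by rewrite addrA -pyramid_gf_eq.
- by move=> w /low_primeP[u Du ->]; rewrite dyck_prime_path.
- by move=> w /and3P[/ddyck_dyck-> ->].
- by rewrite low_prime_path ddyckE dyck_nil.
- by move=> u Du u0; rewrite low_prime_path /A u0.
- move=> u v Du Dv v0; apply/negP => /low_primeP[u' Du' E].
  by move: v0; rewrite (prime_path_cat_nil Du' Du (esym E)).
Qed.

Lemma low_prime_gf d : d < 0 -> path_gf (low_prime d) = xvar * S_gf d.
Proof.
by move=> d0; rewrite low_prime_gf_eq // /S_gf mulrDr pyramid_gf.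
Qed.

(** * The algebraic equation *)

(** Elimination of the Q_i from the system that they satisfy together with S,
in any commutative ring; q stands for y / (1 - x). *)
Lemma algebraic_equation (R : comNzRingType) (x y q S : R) (Q : nat -> R) e :
  y = (1 - x) * q -> S = q + \sum_(j < e) Q j ->
  Q 0%N = x * S * (x * q + Q 0%N) ->
  (forall i, Q i.+1 = x * Q i + x * S * Q i.+1) ->
  (1 - x * S) ^+ e * (y + (1 - y) * x * S) - S * (1 - x * S) ^+ e.+1
    - x ^+ e.+2 * q * S = 0.
Proof.
move=> defy defS Q0 QS; set u := 1 - x * S.
have uQ i : u ^+ i.+1 * Q i = x ^+ i * (x ^+ 2 * S * q).
  elim: i => [|i IHi].
    by rewrite expr1 expr0 /u mulrBl {1}Q0; ring.
  have uQS : u * Q i.+1 = x * Q i by rewrite /u mulrBl {1}QS; ring.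
  by rewrite exprSr -mulrA uQS mulrCA IHi (exprS x i); apply: mulrA.
(* The equation for S multiplied by (u - x) u^e, with the geometric sum
   collapsed by subrXX. *)
have key : (u - x) * (u ^+ e * S) =
    (u - x) * (u ^+ e * q) + (u ^+ e - x ^+ e) * (x ^+ 2 * S * q).
  rewrite {1}defS mulrDr mulrDr; congr (_ + _).
  rewrite subrXX -(mulrA (u - x)); congr (_ * _); rewrite mulr_sumr mulr_suml.
  apply: eq_bigr => j _; rewrite -(mulrA (u ^+ _)) -uQ mulrA -exprD.
  by congr (u ^+ _ * _); have := ltn_ord j; lia.
rewrite (exprS u e) (exprS x e.+1) (exprS x e).
have -> : x * (x * x ^+ e) * q * S = x ^+ 2 * S * q * x ^+ e by ring.
have -> : x ^+ 2 * S * q * x ^+ e =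
    (u - x) * (u ^+ e * q) + u ^+ e * (x ^+ 2 * S * q) - (u - x) * (u ^+ e * S).
  by rewrite key; ring.
by rewrite defy /u; ring.
Qed.

End FirstReturn.

Theorem theorem2p1 (d : int) (hd : d < 0) :
  let e := `|d|%N in
  let x := xvar in
  let y := yvar in
  let Le := L_gf d in
  let Se := S_gf d in
  Le = x * y + x * Le + x * Se * Le
  /\ (1 - x * Se) ^+ e * (y + (1 - y) * x * Se)
     - Se * (1 - x * Se) ^+ e.+1
     - x ^+ e.+2 * y / (1 - x) * Se = 0.
Proof.
move=> e x y Le Se; split.
  by rewrite -low_prime_gf // {1}/Le L_gf_eq.
rewrite -(mulrA _ y); apply: (@algebraic_equation _ _ _ _ _ (Q_gf d)) => //.
- by rewrite mulrC divrK ?subr1_xvar_unit.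
- by rewrite -low_prime_gf // -pyramid_gf; apply: Q_gf0_eq.
- by move=> i; rewrite -low_prime_gf //; apply: Q_gfS_eq.
Qed.
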